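(* Let $n$ be a nonnegative integer and let $a,b,c$ be complex numbers such that no lower parameter of the series below is a nonpositive integer and all denominators below are nonzero. Then $$\frac{(c-a)_n(a-b)_n}{(c)_n(-b)_n}={}_6F_5\left[\begin{matrix}-\frac n2,\ \frac{1-n}{2},\ a,\ 1-a,\ b+c-a,\ a-b-c+1\\ \frac12,\ c,\ 1-c-n,\ b-n+1,\ -b\end{matrix};1\right]$$ $$\qquad-\frac{na(b+c-a)}{b(c+n-1)}\;{}_6F_5\left[\begin{matrix}\frac{1-n}{2},\ \frac{2-n}{2},\ a+1,\ 1-a,\ b+c-a+1,\ a-b-c+1\\ \frac32,\ c,\ 2-c-n,\ b-n+1,\ 1-b\end{matrix};1\right].$$
   Context: $(x)_0=1$ and $(x)_n=x(x+1)\cdots(x+n-1)$ for $n\ge1$. The generalized hypergeometric series is ${}_pF_q\left[\begin{matrix}a_1,\dots,a_p\\ b_1,\dots,b_q\end{matrix};z\right]=\sum_{k\ge0}\frac{(a_1)_k\cdots(a_p)_k}{(b_1)_k\cdots(b_q)_k}\frac{z^k}{k!}$, with lower parameters $b_j\in\mathbb{C}\setminus\mathbb{Z}_{\le0}$. The series involved terminate; a term whose coefficient vanishes because of the factor $n$ (when $n=0$) is read as $0$. *)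

(* Defs.v *)
From mathcomp Require Import all_boot all_order all_algebra.
From mathcomp Require Import all_classical all_reals all_analysis.
From mathcomp Require Import complex.

Set Implicit Arguments.
Unset Strict Implicit.
Unset Printing Implicit Defensive.

Import Order.TTheory GRing.Theory Num.Theory.
Import numFieldNormedType.Exports.

Local Open Scope ring_scope.
Local Open Scope complex_scope.
Local Open Scope classical_set_scope.

(* The complex numbers over R. The numClosedFieldType ascription matters: the
   modulus topology used by [limn] is inferred for carriers of number fields,
   but not for the bare type [R[i]]. *)
Definition Cplx (R : realType) : numClosedFieldType := R[i].

Definition poch (F : numFieldType) (x : F) (n : nat) : F :=
  \prod_(i < n) (x + i%:R).

Definition nonpos_integer (F : numFieldType) (x : F) : Prop :=
  exists k : nat, x = - k%:R.

Definition pFq_term (F : numFieldType) (al be : seq F) (z : F) (k : nat) : F :=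
  (\prod_(x <- al) poch x k) / (\prod_(y <- be) poch y k) * (z ^+ k / k`!%:R).

(* The value is the limit of the partial sums; it is unspecified when the
   series diverges. *)
Definition pFq (F : numFieldType) (al be : seq F) (z : F) : F :=
  limn (series (pFq_term al be z)).

(* Main.v *)
Require Import Defs.
From mathcomp Require Import all_boot all_order all_algebra.
From mathcomp Require Import all_classical all_reals all_analysis.
From mathcomp Require Import complex.
From mathcomp Require Import ring zify.
Import Order.TTheory GRing.Theory Num.Theory.
Import numFieldNormedType.Exports.
Local Open Scope ring_scope.

(** Put d = - b and s = c - d = b + c.  Since
    (c + k - a)(a + d + k) = (c + k)(d + k) + a (s - a),
    the left-hand numerator is a polynomial of degree n in t = a (s - a).
    Likewise (a + v)(s - a + v) = t + v (s + v), so the products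
      N_m = [a]_m [s - a]_m,  [x]_m = x (1 - x) (x + 1) (2 - x) ... (m factors),
    are the Newton basis in t for the nodes a = 0, 1, -1, 2, -2, ...
    The identity is the Newton expansion of the numerator in this basis:
      (c - a)_n (a + d)_n
        = sum_m C(n, m) (c + floor(m/2))_(n-m) (d + ceil(m/2))_(n-m) N_m,
    which is [newton_expansion].  Its coefficients are polynomials in c and d,
    so no denominator has to be tracked.  It is proved by induction on n: a new
    factor (c + n - a)(a + d + n) differs from the next Newton factor
    (a + v)(s - a + v) by the constant (c + n + v)(d + n - v), and the
    resulting recurrence on the coefficients is a Pascal rule weighted by
    Pochhammer symbols ([pascal_poch]).

    After division by (c)_n (d)_n, the terms with m = 2j are those of the first
    hypergeometric series ([newton_term_even]) and the terms with m = 2j + 1 are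
    those of the second one, prefactor included ([newton_term_odd]).  The
    translation uses the duplication formula, which turns the two half-integer
    numerator parameters together with 1/2 (or 3/2) and j! into C(n, m), and the
    reflection (1 - x - n)_q = (-1)^q (x + n - q)_q, which produces the lower
    parameters depending on n. *)

Section NewtonExpansion.
Set Implicit Arguments.
Unset Strict Implicit.
Variable F : numFieldType.
Implicit Types x y a b c d u v : F.

(** * Pochhammer symbols *)

Lemma poch0 x : poch x 0 = 1.
Proof. by rewrite /poch big_ord0. Qed.

Lemma pochS x n : poch x n.+1 = poch x n * (x + n%:R).
Proof. by rewrite /poch big_ord_recr. Qed.

Lemma poch_recl x n : poch x n.+1 = x * poch (x + 1) n.
Proof.
rewrite /poch big_ord_recl addr0; congr (_ * _); apply: eq_bigr => i _.
by rewrite lift0 -addrA nat1r.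
Qed.

Lemma pochD x m n : poch x (m + n) = poch x m * poch (x + m%:R) n.
Proof.
elim: n => [|n IHn]; first by rewrite addn0 poch0 mulr1.
by rewrite addnS !pochS IHn natrD; ring.
Qed.

Lemma poch_reflect x n : poch (1 - x - n%:R) n = (- 1) ^+ n * poch x n.
Proof.
elim: n => [|n IHn]; first by rewrite !poch0 expr0 mulr1.
rewrite poch_recl pochS exprS -natr1.
have -> : 1 - x - (n%:R + 1) + 1 = 1 - x - n%:R by ring.
by rewrite IHn; ring.
Qed.

Lemma poch_duplication x n :
  poch x n.*2 = 4 ^+ n * (poch (x / 2) n * poch ((x + 1) / 2) n).
Proof.
elim: n => [|n IHn]; first by rewrite !poch0 expr0 !mulr1.
rewrite doubleS !pochS IHn exprS -natr1 -addnn natrD; by field.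
Qed.

Lemma poch1 n : poch (1 : F) n = n`!%:R.
Proof.
elim: n => [|n IHn]; first by rewrite poch0 fact0.
by rewrite pochS IHn factS natrM addrC natr1 mulrC.
Qed.

(** The vanishing for m > n, which makes the series terminate, comes from the
    binomial coefficient. *)
Lemma poch_opp_nat (n m : nat) :
  poch (- n%:R : F) m = (- 1) ^+ m * ('C(n, m)%:R * m`!%:R).
Proof.
rewrite -natrM bin_ffact; elim: m => [|m IHm].
  by rewrite poch0 ffactn0 mulr1.
rewrite pochS IHm ffactnSr natrM exprS.
have [le_mn|lt_nm] := leqP m n; first by rewrite natrB //; ring.
by rewrite ffact_small // !mul0r !mulr0 mul0r.
Qed.

(** Cut (x)_n into consecutive blocks of lengths p, n - p - q and q, and reverse
    the last one.  This clears the two lower parameters x and 1 - x - n from a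
    ratio of Pochhammer symbols: what is left of (x)_n is the middle block. *)
Lemma poch_split x n p q : (p + q <= n)%N ->
  (-1) ^+ q * poch x n =
  poch x p * poch (x + p%:R) (n - (p + q)) * poch (1 - x - n%:R) q.
Proof.
move=> le_pqn; have := poch_reflect (x + (n - q)%:R) q.
have -> : 1 - (x + (n - q)%:R) - q%:R = 1 - x - n%:R.
  by rewrite natrB; [ring | lia].
move=> ->; rewrite mulrCA; congr (_ * _).
rewrite -pochD.
have -> : (p + (n - (p + q)) = n - q)%N by lia.
by rewrite -pochD subnK //; lia.
Qed.

(** * The Newton expansion *)

(** The alternating product x (1 - x) (x + 1) (2 - x) ... with m factors. *)
Definition altpoch x m := poch x (uphalf m) * poch (1 - x) m./2.

Definition newton_coef c d n m :=
  'C(n, m)%:R * (poch (c + m./2%:R) (n - m) * poch (d + (uphalf m)%:R) (n - m)).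

(** The m-th factor of [altpoch x], up to sign, is x + node m; the nodes are
    0, -1, 1, -2, 2, ... *)
Definition node m : F := if odd m then - (1 + m./2%:R) else m./2%:R.

(** The signs of the odd factors cancel in the product of the two alternating
    products, so a single formula covers both parities. *)
Lemma altpochS x y m : altpoch x m.+1 * altpoch y m.+1 =
  (x + node m) * (y + node m) * (altpoch x m * altpoch y m).
Proof.
rewrite /altpoch /node /= uphalf_half; case: (odd m) => /=.
  by rewrite add1n !pochS; ring.
by rewrite add0n !pochS; ring.
Qed.

(** The product of Pochhammer symbols common to all three terms factors out; what
    remains is Pascal's rule corrected by
    (m + 1) C(n, m + 1) = (n - m) C(n, m). *)
Lemma pascal_poch u v n m :
  'C(n, m)%:R * (poch u (n - m) * poch v (n - m)) +
  (u + 1 + n%:R) * (v + n%:R - m%:R - 1) *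
    ('C(n, m.+1)%:R * (poch (u + 1) (n - m.+1) * poch v (n - m.+1))) =
  'C(n.+1, m.+1)%:R * (poch (u + 1) (n - m) * poch v (n - m)).
Proof.
have [lt_mn|lt_nm|<-] := ltngtP m n; last 2 first.
- by rewrite !bin_small ?ltnS // 1?ltnW // !mul0r mulr0 addr0.
- by rewrite !binn subnn bin_small // !poch0; ring.
have [l ->] : exists l, n = (m + l.+1)%N by exists (n - m.+1)%N; lia.
rewrite addKn (_ : (m + l.+1 - m.+1)%N = l); last by lia.
rewrite binS natrD poch_recl !pochS.
have : (m.+1%:R * 'C(m + l.+1, m.+1)%:R = l.+1%:R * 'C(m + l.+1, m)%:R :> F).
  by rewrite -!natrM mul_bin_left addKn.
rewrite natrD -!natr1 => E.
set p := poch (u + 1) l; set q := poch v l.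
set B := 'C(_, m.+1)%:R in E *; set C := 'C(_, m)%:R in E *.
apply/eqP; rewrite -subr_eq0; apply/eqP.
transitivity (p * q * (v + l%:R) * ((m%:R + 1) * B - (l%:R + 1) * C)).
  by ring.
by rewrite E subrr mulr0.
Qed.

Lemma newton_coef0S c d n : newton_coef c d n.+1 0 =
  (c + n%:R) * (d + n%:R) * newton_coef c d n 0.
Proof. rewrite /newton_coef !bin0 !subn0 !addr0 !pochS; ring. Qed.

(** Going from m to m + 1 shifts only one of the two base points c + floor(m/2)
    and d + ceil(m/2): the second for even m, the first for odd m.  Both cases
    are therefore [pascal_poch], with the roles of the two factors exchanged. *)
Lemma newton_coefSS c d n m : newton_coef c d n.+1 m.+1 =
  newton_coef c d n m +
  (c + n%:R + node m.+1) * (d + n%:R - node m.+1) * newton_coef c d n m.+1.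
Proof.
rewrite /newton_coef /node /= subSS uphalf_half.
have Em : m%:R = (odd m)%:R + m./2%:R *+ 2 :> F.
  by rewrite -[m in LHS]odd_double_half natrD -mul2n natrM mulr_natl.
case: (odd m) Em => /= Em.
  rewrite add1n -natr1 addrA -pascal_poch Em; ring.
rewrite add0n -natr1 addrA.
rewrite [X in _ * X = _]mulrC -pascal_poch Em [poch (d + _) _ * _]mulrC.
rewrite [poch (d + _ + 1) _ * _]mulrC; ring.
Qed.

Lemma newton_expansion c d a n :
  poch (c - a) n * poch (a + d) n =
  \sum_(m < n.+1) newton_coef c d n m * (altpoch a m * altpoch (c - d - a) m).
Proof.
elim: n => [|n IHn].
  by rewrite big_ord1 /newton_coef /altpoch !poch0 bin0; ring.
pose N m := altpoch a m * altpoch (c - d - a) m.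
rewrite !pochS mulrACA IHn mulr_suml.
(* r m is the difference between the new factor (c + n - a)(a + d + n) and
   the Newton factor (a + node m)(c - d - a + node m). *)
pose r m := (c + n%:R + node m) * (d + n%:R - node m).
transitivity (\sum_(m < n.+1) newton_coef c d n m * N m.+1 +
              \sum_(m < n.+1) r m * newton_coef c d n m * N m).
  rewrite -big_split; apply: eq_bigr => m _ /=.
  rewrite /N altpochS /r; ring.
have -> : \sum_(m < n.+1) r m * newton_coef c d n m * N m =
          \sum_(m < n.+2) r m * newton_coef c d n m * N m.
  rewrite [RHS]big_ord_recr /= [newton_coef _ _ _ n.+1]/newton_coef.
  by rewrite bin_small // mul0r mulr0 mul0r addr0.
rewrite [X in _ + X = _]big_ord_recl [RHS]big_ord_recl addrCA; congr (_ + _).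
  by rewrite newton_coef0S /r /node /= addr0 subr0.
rewrite -big_split; apply: eq_bigr => m _ /=.
by rewrite newton_coefSS -/(r _) /N; ring.
Qed.

(** * Matching the terms of the two series *)

Lemma sum_parity (f : nat -> F) N :
  \sum_(m < N.*2) f m = \sum_(j < N) (f j.*2 + f j.*2.+1).
Proof.
elim: N => [|N IHN]; first by rewrite !big_ord0.
by rewrite doubleS !big_ord_recr IHN /= addrA.
Qed.

(** The partial sums of a terminating series are eventually constant, hence the
    limit defining its value is attained. *)
Lemma pFq_finite (al be : seq F) z N :
  (forall k, (N <= k)%N -> pFq_term al be z k = 0) ->
  pFq al be z = \sum_(k < N) pFq_term al be z k.
Proof.
move=> z_term; rewrite /pFq.
apply: cvg_lim; first exact: norm_hausdorff.
apply: cvg_near_cst; exists N => // k /= le_Nk.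
rewrite /series /= (@big_cat_nat _ _ _ N) //= big_mkord.
rewrite [X in _ + X](_ : _ = 0) ?addr0 //.
rewrite big_nat_cond big1 // => i /andP[/andP[? _] _]; exact: z_term.
Qed.

(** The duplication formula at x = 1. *)
Lemma poch_half_fact j : (j.*2)`!%:R = 4 ^+ j * (poch (1 / 2 : F) j * j`!%:R).
Proof.
rewrite -poch1 poch_duplication (_ : (1 + 1) / 2 = 1 :> F) ?poch1 //.
by field.
Qed.

(** The duplication formula at x = 2, as (2j + 1)! = (2)_(2j). *)
Lemma poch_three_halves_fact j :
  (j.*2.+1)`!%:R = 4 ^+ j * (poch (3 / 2 : F) j * j`!%:R).
Proof.
rewrite -poch1 poch_recl mul1r poch_duplication -poch1.
rewrite (_ : (1 + 1) / 2 = 1 :> F); last by field.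
by rewrite (_ : 1 + 1 + 1 = 3 :> F) 1?[RHS]mulrCA; ring.
Qed.

(** The duplication formula at x = - n. *)
Lemma poch_bin_even n j :
  poch (- (n%:R / 2) : F) j * poch ((1 - n%:R) / 2) j =
  'C(n, j.*2)%:R * poch (1 / 2) j * j`!%:R.
Proof.
apply: (@mulfI _ (4 ^+ j)); first by rewrite expf_neq0 ?pnatr_eq0.
have := poch_duplication (- n%:R) j.
rewrite poch_opp_nat -signr_odd odd_double expr0 mul1r poch_half_fact.
by rewrite mulNr [- _ + 1]addrC => <-; ring.
Qed.

(** The duplication formula at x = 1 - n; the factor n completes (1 - n)_(2j)
    to (- n)_(2j + 1), up to sign. *)
Lemma poch_bin_odd n j :
  n%:R * (poch ((1 - n%:R) / 2 : F) j * poch ((2 - n%:R) / 2) j) =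
  'C(n, j.*2.+1)%:R * poch (3 / 2) j * j`!%:R.
Proof.
apply: (@mulfI _ (4 ^+ j)); first by rewrite expf_neq0 ?pnatr_eq0.
have := poch_opp_nat n j.*2.+1.
rewrite poch_recl poch_duplication -signr_odd /= odd_double expr1.
rewrite poch_three_halves_fact (_ : - n%:R + 1 + 1 = 2 - n%:R); last by ring.
rewrite [- _ + 1]addrC mulN1r mulNr => /oppr_inj E.
by rewrite mulrCA E; ring.
Qed.

Definition newton_term n a b c m : F :=
  newton_coef c (- b) n m * (altpoch a m * altpoch (c - - b - a) m) /
  (poch c n * poch (- b) n).

Lemma newton_term_small n a b c m : (n < m)%N -> newton_term n a b c m = 0.
Proof.
by move=> lt_nm; rewrite /newton_term /newton_coef bin_small // !mul0r.
Qed.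

(** For n = 0 this would fail: the upper parameters are then 1/2 and 1, and only
    the prefactor of the second series vanishes. *)
Lemma odd_series_term_small n (al be : seq F) z k :
  (0 < n)%N -> (n < k.*2.+1)%N ->
  pFq_term ((1 - n%:R) / 2 :: (2 - n%:R) / 2 :: al) be z k = 0.
Proof.
move=> n_gt0 lt_nk; rewrite /pFq_term !big_cons [poch _ k * (_ * _)]mulrA.
suff -> : poch ((1 - n%:R) / 2 : F) k * poch ((2 - n%:R) / 2) k = 0.
  by rewrite !mul0r.
apply: (@mulfI _ n%:R); first by rewrite pnatr_eq0 -lt0n.
by rewrite poch_bin_odd bin_small // !mul0r mulr0.
Qed.

(** For 2j > n both sides vanish through C(n, 2j).  For 2j <= n the lower
    Pochhammer symbols are blocks of (c)_n and (- b)_n, so they are nonzero as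
    soon as these two are. *)
Lemma newton_term_even n a b c j : poch c n * poch (- b) n != 0 ->
  pFq_term
    [:: - (n%:R / 2); (1 - n%:R) / 2; a; 1 - a; b + c - a; a - b - c + 1]
    [:: 1 / 2; c; 1 - c - n%:R; b - n%:R + 1; - b] 1 j =
  newton_term n a b c j.*2.
Proof.
move=> hden; rewrite /pFq_term /newton_term /newton_coef /altpoch.
rewrite !big_cons !big_nil !mulr1 expr1n uphalf_double doubleK.
rewrite [poch (- (_ / 2)) j * _]mulrA poch_bin_even.
have [lt_nj|le_jn] := ltnP n j.*2; first by rewrite bin_small // !mul0r.
have E : (j + j)%N = j.*2 by rewrite addnn.
have Sc := @poch_split c n j j; have Sb := @poch_split (- b) n j j.
rewrite E in Sc Sb; move: (Sc le_jn) (Sb le_jn) => {}Sc {}Sb.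
rewrite (_ : 1 - - b - n%:R = b - n%:R + 1) in Sb; last by ring.
have -> : c - - b - a = b + c - a by ring.
have -> : 1 - (b + c - a) = a - b - c + 1 by ring.
have X : poch c n * poch (- b) n =
  ((-1) ^+ j * poch c n) * ((-1) ^+ j * poch (- b) n).
  by rewrite mulrACA -expr2 sqrr_sign mul1r.
move: hden; rewrite X Sc Sb !mulf_eq0 !negb_or.
move=> /andP[/andP[/andP[c1 c2] c3] /andP[/andP[b1 b2] b3]].
have h : poch (1 / 2 : F) j != 0 /\ j`!%:R != 0 :> F.
  have := fact_gt0 j.*2; rewrite lt0n -(pnatr_eq0 F) poch_half_fact.
  by rewrite !mulf_eq0 !negb_or => /and3P[].
case: h => h1 h2; field.
by rewrite b3 b2 b1 c3 c2 c1 h2 h1.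
Qed.

(** The prefactor supplies the leading factors of (a)_(j+1), (b + c - a)_(j+1),
    (- b)_(j+1) and (1 - c - n)_(j+1), hence the unequal block lengths j and
    j + 1.  The reversed blocks have lengths j + 1 and j, so one sign survives:
    it cancels the minus sign in front of the prefactor, while the signs in
    b (c + n - 1) = (- b)(1 - c - n) cancel each other. *)
Lemma newton_term_odd n a b c j : poch c n * poch (- b) n != 0 ->
  b * (c + n%:R - 1) != 0 ->
  - (n%:R * a * (b + c - a) / (b * (c + n%:R - 1)) *
  pFq_term
    [:: (1 - n%:R) / 2; (2 - n%:R) / 2; a + 1; 1 - a;
        b + c - a + 1; a - b - c + 1]
    [:: 3 / 2; c; 2 - c - n%:R; b - n%:R + 1; 1 - b] 1 j) =
  newton_term n a b c j.*2.+1.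
Proof.
move=> hden hden2; rewrite /pFq_term /newton_term /newton_coef /altpoch.
rewrite !big_cons !big_nil !mulr1 expr1n /= uphalf_double doubleK.
have -> : c - - b - a = b + c - a by ring.
have -> : 1 - (b + c - a) = a - b - c + 1 by ring.
rewrite !(poch_recl _ j).
set P1 := poch ((1 - n%:R) / 2) j; set P2 := poch ((2 - n%:R) / 2) j.
set Q := poch (3 / 2) j; set f := j`!%:R.
have H : n%:R * (P1 * P2) = 'C(n, j.*2.+1)%:R * Q * f by exact: poch_bin_odd.
have [Q0 f0] : Q != 0 /\ f != 0.
  have := fact_gt0 j.*2.+1; rewrite lt0n -(pnatr_eq0 F) poch_three_halves_fact.
  by rewrite !mulf_eq0 !negb_or => /and3P[].
set A := poch (a + 1) j; set A' := poch (1 - a) j.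
set B := poch (b + c - a + 1) j; set B' := poch (a - b - c + 1) j.
have [lt_nj|le_jn] := ltnP n j.*2.+1.
  move: H; rewrite bin_small // !mul0r => H.
  transitivity (- (n%:R * (P1 * P2)) *
    (a * (b + c - a) / (b * (c + n%:R - 1)) *
     (A * A' * B * B' /
      (Q * (poch c j * (poch (2 - c - n%:R) j *
                        (poch (b - n%:R + 1) j * poch (1 - b) j)))) / f))).
    by ring.
  by rewrite H; ring.
have Sc := @poch_split c n j j.+1; have Sb := @poch_split (- b) n j.+1 j.
rewrite addnS addnn in Sc; rewrite addSn addnn in Sb.
move: (Sc le_jn) (Sb le_jn) => {}Sc {}Sb.
rewrite (_ : 1 - - b - n%:R = b - n%:R + 1) in Sb; last by ring.
have X : poch c n * poch (- b) n =
  - ((-1) ^+ j.+1 * poch c n) * ((-1) ^+ j * poch (- b) n).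
  by rewrite exprS mulN1r !mulNr opprK mulrACA -expr2 sqrr_sign mul1r.
rewrite !(poch_recl _ j) in Sc Sb.
rewrite (_ : 1 - c - n%:R + 1 = 2 - c - n%:R) in Sc; last by ring.
rewrite [- b + 1]addrC in Sb.
move: hden; rewrite X Sc Sb mulNr oppr_eq0 !mulf_eq0 !negb_or.
move=> /andP[/andP[/andP[c1 c2] /andP[c3 c4]] /andP[/andP[/andP[b1 b2] b3] b4]].
move: hden2; rewrite mulf_eq0 negb_or => /andP[b0 c0].
move: H c1 c2 c3 c4 b1 b2 b3 b4.
set C1 := poch c j; set C2 := poch (c + _) _; set C4 := poch (2 - _ - _) j.
set B2 := poch (1 - b) _; set B3 := poch (- b + _) _; set B4 := poch _ j.
move=> H c1 c2 c3 c4 b1 b2 b3 b4.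
transitivity (- (n%:R * (P1 * P2)) * (a * (b + c - a) / (b * (c + n%:R - 1)) *
    (A * A' * B * B' / (Q * (C1 * (C4 * (B4 * B2)))) / f))).
  by ring.
rewrite H; field.
by rewrite b4 b3 b2 b0 c4 c3 c2 c1 f0 Q0 c0.
Qed.

End NewtonExpansion.

Theorem theorem4p1 (R : realType) (n : nat) (a b c : Cplx R)
    (hlow1 : forall y : Cplx R,
       y \in [:: 1 / 2; c; 1 - c - n%:R; b - n%:R + 1; - b] ->
       ~ nonpos_integer y)
    (hlow2 : forall y : Cplx R,
       y \in [:: 3 / 2; c; 2 - c - n%:R; b - n%:R + 1; 1 - b] ->
       ~ nonpos_integer y)
    (hden1 : poch c n * poch (- b) n != 0)
    (hden2 : b * (c + n%:R - 1) != 0) :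
  poch (c - a) n * poch (a - b) n / (poch c n * poch (- b) n) =
  pFq [:: - (n%:R / 2); (1 - n%:R) / 2; a; 1 - a; b + c - a; a - b - c + 1]
      [:: 1 / 2; c; 1 - c - n%:R; b - n%:R + 1; - b] 1
  - n%:R * a * (b + c - a) / (b * (c + n%:R - 1)) *
    pFq [:: (1 - n%:R) / 2; (2 - n%:R) / 2; a + 1; 1 - a;
            b + c - a + 1; a - b - c + 1]
        [:: 3 / 2; c; 2 - c - n%:R; b - n%:R + 1; 1 - b] 1.
Proof.
set al1 := - (_ / 2) :: _; set be1 := 1 / 2 :: _.
set al2 := (1 - _) / 2 :: (2 - _) / 2 :: _; set be2 := 3 / 2 :: _.
set K := n%:R * _ * _ / _.
pose t1 := pFq_term al1 be1 1; pose t2 := pFq_term al2 be2 1.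
have even_term j : t1 j = newton_term n a b c j.*2 by exact: newton_term_even.
have odd_term j : - (K * t2 j) = newton_term n a b c j.*2.+1.
  exact: newton_term_odd.
have sum1 : pFq al1 be1 1 = \sum_(j < n.+1) t1 j.
  apply: pFq_finite => k lt_nk.
  by rewrite [LHS]even_term newton_term_small //; lia.
have sum2 : K * pFq al2 be2 1 = K * \sum_(j < n.+1) t2 j.
  have [n0|n_gt0] := posnP n; first by rewrite /K n0 !mul0r.
  congr (_ * _); apply: pFq_finite => k lt_nk.
  by apply: odd_series_term_small => //; lia.
rewrite newton_expansion mulr_suml sum1 sum2 mulr_sumr -sumrN.
rewrite (eq_bigr _ (fun (j : 'I_n.+1) _ => even_term j)).
rewrite [X in _ = _ + X](eq_bigr _ (fun (j : 'I_n.+1) _ => odd_term j)).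
rewrite -[RHS]big_split /=.
(* The pairs run up to m = 2n + 1; the terms with m > n vanish. *)
rewrite -(sum_parity (newton_term n a b c)) -addnn big_split_ord /=.
rewrite [X in _ = _ + X]big1 ?addr0 // => i _.
by rewrite newton_term_small //; lia.
Qed.
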